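(* Let $N\geqslant 1$ and let $\mathcal I$ be the set of all $X\in\mathcal C(\mathbb R^N)$ such that for some non-zero linear subspace $L\subset\mathbb R^N$ the following holds: $|p_L X|>1$ and $p_L X$ has an isolated point. Then $\mathcal I$ is a meager $F_\sigma$ subset of $\mathcal C(\mathbb R^N)$.
   Context: A Cantor set is any topological space homeomorphic to the standard middle-thirds Cantor set. $\mathcal C(\mathbb R^N)$ is the set of all subsets of $\mathbb R^N$ that are Cantor sets, endowed with the Hausdorff metric $d_H(X,Y)=\inf\{\varepsilon>0 \mid X\subset O(Y,\varepsilon),\ Y\subset O(X,\varepsilon)\}$, where $O(X,\varepsilon)=\{y\in\mathbb R^N\mid d(y,X)<\varepsilon\}$ and $d$ is the Euclidean distance. For a linear subspace $L\subset\mathbb R^N$, $p_L$ is the orthogonal projection of $\mathbb R^N$ into $L$, and $p_L X$ is the image of $X$. $|A|$ denotes the cardinality of a set $A$. Meager means being a countable union of nowhere dense subsets (of $\mathcal C(\mathbb R^N)$). *)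

(* Defs.v *)
From HB Require Import structures.
From mathcomp Require Import all_boot all_order all_algebra.
From mathcomp Require Import all_classical all_reals all_analysis.
From mathcomp Require Import ring lra.

Set Implicit Arguments.
Unset Strict Implicit.
Unset Printing Implicit Defensive.

Import Order.TTheory GRing.Theory Num.Theory.
Import numFieldNormedType.Exports.

Local Open Scope classical_set_scope.
Local Open Scope ring_scope.

Definition homeomorphic (S T : topologicalType) : Prop :=
  exists (f : S -> T) (g : T -> S),
    [/\ continuous f, continuous g, cancel f g & cancel g f].

Definition nowhere_dense (T : topologicalType) (A : set T) : Prop :=
  (closure A)° = set0.

Definition meager (T : topologicalType) (A : set T) : Prop :=
  exists2 F : (set T)^nat, (forall i, nowhere_dense (F i)) & A = \bigcup_i F i.

Section MiddleThirds.
Variable R : realType.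

Fixpoint middle_thirds_step (n : nat) : set R :=
  if n is m.+1 then
    (fun x => x / 3) @` middle_thirds_step m `|`
    (fun x => (x + 2) / 3) @` middle_thirds_step m
  else `[0, 1].

Definition middle_thirds : set R := \bigcap_n middle_thirds_step n.

(* [middle_thirds] is coerced to the type of its elements, with the subspace
   topology. *)
Definition is_cantor_space (T : topologicalType) : Prop :=
  homeomorphic T middle_thirds.

Lemma middle_thirds_compact : compact middle_thirds.
Proof.
have stepc n : compact (middle_thirds_step n).
  elim: n => [|n IH] /=; first exact: segment_compact.
  apply: compactU; apply: continuous_compact => //;
    apply: continuous_subspaceT => x.
  - exact: cvgMl.
  - by apply: cvgMl; apply: cvgD => //; exact: cvg_cst.
apply: (subclosed_compact _ (stepc 0%N)); last by move=> x; apply.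
by apply: closed_bigI => n _; apply: compact_closed.
Qed.

Lemma middle_thirds0 : middle_thirds 0.
Proof.
move=> n _; elim: n => [|n IH] /=; first by rewrite in_itv /= lexx ler01.
by left; exists 0 => //; rewrite mul0r.
Qed.

End MiddleThirds.
Arguments middle_thirds_step : clear implicits.
Arguments middle_thirds : clear implicits.

Section Euclidean.
Context {R : realType} {N : nat}.
Implicit Types (u v w x y z : 'rV[R]_N) (X Y Z : set 'rV[R]_N) (e : R).
Implicit Types L : {vspace 'rV[R]_N}.

Definition dotv u v : R := \sum_(i < N) u ord0 i * v ord0 i.

(* The library metric on ['rV[R]_N] is the sup-distance; it induces the same
   topology as the Euclidean distance. *)
Definition eucl_dist x y : R := Num.sqrt (dotv (x - y) (x - y)).

Definition dist_to_set y X : R := inf [set eucl_dist y x | x in X].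

Definition open_nbhd X e : set 'rV[R]_N := [set y | dist_to_set y X < e].

Definition hausdorff_dist X Y : R :=
  inf [set e | [/\ 0 < e, X `<=` open_nbhd Y e & Y `<=` open_nbhd X e]].

Lemma dotvC u v : dotv u v = dotv v u.
Proof. by apply: eq_bigr => i _; rewrite mulrC. Qed.

Lemma dotvDl u v w : dotv (u + v) w = dotv u w + dotv v w.
Proof. by rewrite -big_split; apply: eq_bigr => i _; rewrite mxE mulrDl. Qed.

Lemma dotvZl a u v : dotv (a *: u) v = a * dotv u v.
Proof. by rewrite mulr_sumr; apply: eq_bigr => i _; rewrite mxE mulrA. Qed.

Lemma dotvDr u v w : dotv w (u + v) = dotv w u + dotv w v.
Proof. by rewrite dotvC dotvDl !(dotvC w). Qed.

Lemma dotvZr a u v : dotv u (a *: v) = a * dotv u v.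
Proof. by rewrite dotvC dotvZl dotvC. Qed.

Lemma dot0v u : dotv 0 u = 0.
Proof. by rewrite -(scale0r 0) dotvZl mul0r. Qed.

Lemma dotv0 u : dotv u 0 = 0.
Proof. by rewrite dotvC dot0v. Qed.

Lemma dotvv_ge0 u : 0 <= dotv u u.
Proof. by apply: sumr_ge0 => i _; rewrite -expr2 sqr_ge0. Qed.

Lemma dotvv_eq0 u : dotv u u = 0 -> u = 0.
Proof.
move=> /eqP; rewrite psumr_eq0; last by move=> i _; rewrite -expr2 sqr_ge0.
move=> /allP u0; apply/rowP => i; rewrite mxE.
by have := u0 i (mem_index_enum i); rewrite mulf_eq0 orbb => /eqP.
Qed.

Fact dotv_bilinear :
  bilinear_for (GRing.Scale.Law.clone _ _ *%R _)
    (GRing.Scale.Law.clone _ _ (idfun \; *%R) _) dotv.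
Proof.
split=> [u|u] a x y /=; first by rewrite dotvDl dotvZl.
by rewrite dotvDr dotvZr.
Qed.

HB.instance Definition _ := bilinear_isBilinear.Build R 'rV[R]_N 'rV[R]_N R
  (GRing.Scale.Law.clone _ _ *%R _)
  (GRing.Scale.Law.clone _ _ (idfun \; *%R) _) dotv dotv_bilinear.

Fact dotv_hermitian u v : dotv u v = (-1) ^+ false * idfun (dotv v u).
Proof. by rewrite expr0 mul1r dotvC. Qed.

HB.instance Definition _ := isHermitianSesquilinear.Build R 'rV[R]_N false idfun
  dotv dotv_hermitian.

Fact dotv_gt0 u : u != 0 -> 0 < dotv u u.
Proof.
move=> u0; rewrite lt_neqAle dotvv_ge0 andbT eq_sym.
by apply: contra u0 => /eqP/dotvv_eq0 ->.
Qed.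

HB.instance Definition _ := isDotProduct.Build R 'rV[R]_N dotv dotv_gt0.

Lemma orthov_decomp L x :
  exists2 y, y \in L & {in L, forall z, dotv (x - y) z = 0}.
Proof.
rewrite -(span_basis (vbasisP L)); elim: (tval (vbasis L)) x => [|v s IH] x.
  exists 0; first exact: mem0v.
  by move=> z; rewrite span_nil memv0 => /eqP ->; rewrite dotv0.
have [p ps vp] := IH v; have [y ys xy] := IH x.
pose w := v - p; pose c := dotv (x - y) w / dotv w w.
have ww : c * dotv w w = dotv (x - y) w.
  have [w0|w0] := eqVneq (dotv w w) 0; last exact: divfK.
  by rewrite w0 mulr0 (dotvv_eq0 w0) dotv0.
have sub : (<< s >> <= <<v :: s>>)%VS by rewrite span_cons addvSr.
have ws : w \in <<v :: s>>%VS.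
  by rewrite rpredB ?(subvP sub p)// memv_span ?mem_head.
exists (y + c *: w); first by rewrite rpredD ?rpredZ ?(subvP sub y).
move=> z; rewrite span_cons => /memv_addP[_ /vlineP[a ->] [t ts ->]].
have -> : a *: v + t = a *: w + (a *: p + t).
  by rewrite addrA -scalerDr subrK.
have ps' : a *: p + t \in << s >>%VS by rewrite rpredD ?rpredZ.
have -> : x - (y + c *: w) = (x - y) + (- c) *: w 
  by rewrite scaleNr opprD addrA.
have {vp}wp := vp _ ps'; rewrite -/w in wp.
move: wp (xy _ ps') ww; clearbody c w; clear ws; move: w (x - y) (_ + t).
move=> {}w d q wq dq ww.
by rewrite dotvDr dotvZr !dotvDl !dotvZl wq dq mulNr ww subrr !mulr0 !addr0.
Qed.

Definition orth_proj L x : 'rV[R]_N := daddv_pi L (orthov dotv L) x.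

(* [daddv_pi] is only meaningful for complementary subspaces; this is where
   [L] and its orthogonal are shown to be complementary. *)
Lemma orth_projP L x :
  orth_proj L x \in L /\ {in L, forall z, dotv (x - orth_proj L x) z = 0}.
Proof.
have LI0 : (L :&: orthov dotv L = 0)%VS.
  apply/eqP; rewrite -subv0; apply/subvP => v; rewrite memv_cap => /andP[vL].
  by move=> /mem_orthovP/(_ v vL)/dotvv_eq0 ->; exact: mem0v.
split; first exact: memv_pi.
apply/mem_orthovP; have [y yL xy] := orthov_decomp L x.
have xLO : x \in (L + orthov dotv L)%VS.
  apply/memv_addP; exists y => //; exists (x - y); first exact/mem_orthovP.
  by rewrite addrC subrK.
by rewrite -{1}(daddv_pi_add LI0 xLO) addrC addKr memv_pi.
Qed.

Lemma dotv_CS u v : dotv u v <= Num.sqrt (dotv u u) * Num.sqrt (dotv v v).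
Proof.
rewrite -sqrtrM ?dotvv_ge0// (le_trans (ler_norm _))// -sqrtr_sqr ler_wsqrtr//.
have [v0|v0] := eqVneq (dotv v v) 0.
  by rewrite v0 mulr0 (dotvv_eq0 v0) dotv0 expr0n.
have vp : 0 < dotv v v by rewrite lt_neqAle eq_sym v0 dotvv_ge0.
have := dotvv_ge0 (dotv v v *: u - dotv u v *: v).
rewrite -scaleNr !(dotvDl, dotvDr, dotvZl, dotvZr) (dotvC v u).
set a := dotv u u; set b := dotv u v; set c := dotv v v in vp *.
have -> : c * (c * a + - b * b) + (c * (- b * b) + - b * (- b * c)) =
    c * (a * c - b ^+ 2) by ring.
by rewrite pmulr_rge0// subr_ge0.
Qed.

Lemma eucl_dist_ge0 x y : 0 <= eucl_dist x y.
Proof. exact: sqrtr_ge0. Qed.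

Lemma eucl_distxx x : eucl_dist x x = 0.
Proof. by rewrite /eucl_dist subrr dotv0 sqrtr0. Qed.

Lemma eucl_distC x y : eucl_dist x y = eucl_dist y x.
Proof.
by rewrite /eucl_dist -opprB -scaleN1r dotvZl dotvZr mulrA mulrNN !mul1r.
Qed.

Lemma eucl_dist_triangle y x z : eucl_dist x z <= eucl_dist x y + eucl_dist y z.
Proof.
have -> : eucl_dist x z =
    Num.sqrt (dotv ((x - y) + (y - z)) ((x - y) + (y - z))).
  by rewrite /eucl_dist addrA subrK.
rewrite -[leRHS]ger0_norm ?addr_ge0 ?eucl_dist_ge0// -sqrtr_sqr ler_wsqrtr//.
rewrite /eucl_dist; move: (x - y) (y - z) => u v.
rewrite !(dotvDl, dotvDr) (dotvC v u) sqrrD !sqr_sqrtr ?dotvv_ge0//.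
by have := dotv_CS u v; set s := Num.sqrt _ * _; lra.
Qed.

Lemma coord_le_eucl x y i : `|(x - y) ord0 i| <= eucl_dist x y.
Proof.
rewrite -sqrtr_sqr ler_wsqrtr// /dotv (bigD1 i)//= expr2 lerDl.
by apply: sumr_ge0 => j _; rewrite -expr2 sqr_ge0.
Qed.

Lemma eucl_le_norm x y : eucl_dist x y <= Num.sqrt N%:R * `|x - y|.
Proof.
rewrite -[X in _ * X]normr_id -sqrtr_sqr -sqrtrM ?ler0n// ler_wsqrtr//.
rewrite -[N in N%:R]card_ord mulr_natl -sumr_const ler_sum// => i _.
rewrite -expr2 -real_normK ?num_real// lerXn2r ?nnegrE//.
by rewrite [leRHS]mx_normrE; exact: (le_bigmax _ _ (ord0, i)).
Qed.

Lemma open_nbhdP X e y : X !=set0 ->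
  open_nbhd X e y <-> exists2 x, X x & eucl_dist y x < e.
Proof.
move=> [x0 Xx0]; have hinf : has_inf [set eucl_dist y x | x in X].
  split; first by exists (eucl_dist y x0), x0.
  by exists 0 => _ [x _ <-]; exact: eucl_dist_ge0.
split=> [/(inf_lt hinf.1)[_ [x Xx <-] ?]|[x Xx]]; first by exists x.
by apply: le_lt_trans; apply: ge_inf; [exact: hinf.2|exists x].
Qed.

Section HausdorffMetric.
Variables X Y Z : set 'rV[R]_N.
Hypotheses (X0 : X !=set0) (Y0 : Y !=set0) (Z0 : Z !=set0).
Hypotheses (cX : compact X) (cY : compact Y) (cZ : compact Z).

Lemma hausdorff_dist_has_inf :
  has_inf [set e | [/\ 0 < e, X `<=` open_nbhd Y e & Y `<=` open_nbhd X e]].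
Proof.
split; last by exists 0 => e [/ltW].
have [M [_ XM]] := compact_bounded cX; have [M' [_ YM]] := compact_bounded cY.
pose B := `|M| + `|M'| + 1; pose r := Num.sqrt N%:R * (B + B) + 1.
have bnd A K : (forall k, K < k -> forall x, A x -> `|x| <= k) -> `|K| < B ->
    forall x, A x -> `|x| <= B.
  by move=> AK KB; apply: AK; rewrite (le_lt_trans (ler_norm _)).
have {}XM := bnd X M XM; have {}YM := bnd Y M' YM.
have MB : `|M| < B by rewrite /B -addrA ltrDl ltr_wpDl.
have MB' : `|M'| < B by rewrite /B addrAC ltrDr ltr_wpDl.
have {}XM := XM MB; have {}YM := YM MB'.
have B0 : 0 <= B by rewrite /B !addr_ge0.
have dr x y : X x -> Y y -> eucl_dist x y < r.
  move=> Xx Yy; rewrite (le_lt_trans (eucl_le_norm x y))// /r ltr_pwDr//.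
  rewrite ler_wpM2l ?sqrtr_ge0// (le_trans (ler_normB _ _))// lerD//.
  - exact: XM.
  - exact: YM.
exists r; split.
- by rewrite /r ltr_wpDl// mulr_ge0 ?sqrtr_ge0 ?addr_ge0.
- move=> x Xx; apply/open_nbhdP => //; have [y Yy] := Y0; exists y => //.
  exact: dr.
- move=> y Yy; apply/open_nbhdP => //; have [x Xx] := X0; exists x => //.
  by rewrite eucl_distC; exact: dr.
Qed.

Lemma hausdorff_distP e : hausdorff_dist X Y < e ->
  [/\ X `<=` open_nbhd Y e & Y `<=` open_nbhd X e].
Proof.
move=> /(inf_lt hausdorff_dist_has_inf.1)[d [d0 XY YX] de].
by split=> z => [/XY|/YX]; rewrite /open_nbhd /= => /lt_trans; apply.
Qed.

Lemma hausdorff_dist_le e : 0 < e ->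
  X `<=` open_nbhd Y e -> Y `<=` open_nbhd X e -> hausdorff_dist X Y <= e.
Proof. by move=> e0 XY YX; apply: ge_inf => //; exists 0 => d [/ltW]. Qed.

Lemma hausdorff_dist_eq0_sub : hausdorff_dist X Y = 0 -> X `<=` Y /\ Y `<=` X.
Proof.
move=> XY0.
have sub A B : compact B -> B !=set0 ->
    (forall e, 0 < e -> A `<=` open_nbhd B e) -> A `<=` B.
  move=> cB B0 AB x Ax; apply: (compact_closed (@norm_hausdorff _ _) cB) => U.
  move=> /nbhs_ballP[e /= e0 eU].
  have /(open_nbhdP _ _ B0)[y By xy] := AB e e0 x Ax.
  exists y; split => //; apply: eU; split=> // i j; rewrite ord1.
  have := coord_le_eucl x y j; rewrite !mxE => /le_lt_trans; exact.
by split; apply: sub => // e e0; case: (@hausdorff_distP e) => //; rewrite XY0.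
Qed.

End HausdorffMetric.

Lemma hausdorff_distxx X : X !=set0 -> compact X -> hausdorff_dist X X = 0.
Proof.
move=> X0 cX; apply/eqP; rewrite eq_le; apply/andP; split.
  apply/ler_addgt0Pl => e e0; rewrite addr0.
  by apply: hausdorff_dist_le => // x Xx; apply/open_nbhdP => //;
    exists x; rewrite ?eucl_distxx.
apply: lb_le_inf; last by move=> e [/ltW].
exact: (hausdorff_dist_has_inf X0 X0 cX cX).1.
Qed.

Lemma hausdorff_distC X Y : hausdorff_dist X Y = hausdorff_dist Y X.
Proof. by congr inf; apply/seteqP; split=> e [? ? ?]. Qed.

Lemma hausdorff_dist_triangle Y X Z : X !=set0 -> Y !=set0 -> Z !=set0 ->
  compact X -> compact Y -> compact Z ->
  hausdorff_dist X Z <= hausdorff_dist X Y + hausdorff_dist Y Z.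
Proof.
move=> X0 Y0 Z0 cX cY cZ; apply/ler_addgt0Pl => e e0.
have sum A B C a b : B !=set0 -> C !=set0 ->
    A `<=` open_nbhd B a -> B `<=` open_nbhd C b -> A `<=` open_nbhd C (a + b).
  move=> B0 C0 AB BC x /AB/(open_nbhdP _ _ B0)[y].
  move=> /BC/(open_nbhdP _ _ C0)[z Cz yz] xy.
  apply/open_nbhdP => //; exists z => //.
  by rewrite (le_lt_trans (eucl_dist_triangle y x z))// ltrD.
have e2 : 0 < e / 2 by rewrite divr_gt0.
have ge0 A B : A !=set0 -> B !=set0 -> compact A -> compact B ->
    0 <= hausdorff_dist A B.
  move=> A0 B0 cA cB.
  apply: lb_le_inf; last by move=> d [/ltW].
  exact: (hausdorff_dist_has_inf A0 B0 cA cB).1.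
have lt_e2 A B : hausdorff_dist A B < hausdorff_dist A B + e / 2.
  by rewrite ltrDl.
have [XY YX] := hausdorff_distP X0 Y0 cX cY (lt_e2 X Y).
have [YZ ZY] := hausdorff_distP Y0 Z0 cY cZ (lt_e2 Y Z).
have -> : e + (hausdorff_dist X Y + hausdorff_dist Y Z) =
  (hausdorff_dist X Y + e / 2) + (hausdorff_dist Y Z + e / 2).
  by rewrite addrACA -splitr addrC.
apply: hausdorff_dist_le.
- by apply: addr_gt0; apply: ltr_wpDl => //; exact: ge0.
- exact: sum XY YZ.
- by rewrite addrC; exact: sum ZY YX.
Qed.

End Euclidean.
Arguments dotv {R N} u v.

Record cantor_sets (R : realType) (N : nat) := CantorSet {
  cantor_set_val :> set 'rV[R]_N;
  cantor_setP : is_cantor_space R cantor_set_val }.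

HB.instance Definition _ (R : realType) (N : nat) :=
  gen_eqMixin (cantor_sets R N).
HB.instance Definition _ (R : realType) (N : nat) :=
  gen_choiceMixin (cantor_sets R N).

Section CantorSets.
Context {R : realType} {N : nat}.
Implicit Types X Y Z : cantor_sets R N.

Lemma cantor_set_image X :
  exists2 f : R -> 'rV[R]_N, {within middle_thirds R, continuous f} &
    f @` middle_thirds R = X.
Proof.
case: X => X /= [f [g [cf cg fK gK]]].
pose h := valL_ 0 (set_val \o g : middle_thirds R -> 'rV[R]_N).
have hE (t : middle_thirds R) : h (set_val t) = set_val (g t).
  by rewrite /h -[LHS]/((sigL _ (valL_ 0 (set_val \o g))) t) valLK.
exists h.
  apply/subspace_valL_continuousP' => t; apply: continuous_comp.
    exact: cg.
  exact: initial_continuous.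
apply/seteqP; split=> [_ [t Ct <-]|x Xx].
  have -> : t = set_val (exist _ t (mem_set Ct) : middle_thirds R).
    by rewrite set_valE.
  by rewrite hE; exact: set_valP.
exists (set_val (f (exist _ x (mem_set Xx)))); first exact: set_valP.
by rewrite hE fK.
Qed.

Lemma cantor_set_compact X : compact X.
Proof.
have [f cf <-] := cantor_set_image X.
exact: continuous_compact cf (@middle_thirds_compact R).
Qed.

Lemma cantor_set_neq0 X : X !=set0.
Proof.
have [f _ <-] := cantor_set_image X.
by exists (f 0), 0 => //; exact: middle_thirds0.
Qed.

Let mdist X Y : R := hausdorff_dist X Y.

Let mdistxx X : mdist X X = 0.
Proof.
by apply: hausdorff_distxx; [exact: cantor_set_neq0|exact: cantor_set_compact].
Qed.

Let mdist_positivity X Y : mdist X Y = 0 -> X = Y.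
Proof.
have cX := @cantor_set_compact X; have cY := @cantor_set_compact Y.
move=> /(hausdorff_dist_eq0_sub (cantor_set_neq0 X) (cantor_set_neq0 Y) cX cY).
case: X Y {cX cY} => [X cX] [Y cY] /= [XY YX].
have XeY : X = Y by apply/seteqP.
by subst Y; congr CantorSet; exact: Prop_irrelevance.
Qed.

Let mdist_sym X Y : mdist X Y = mdist Y X.
Proof. exact: hausdorff_distC. Qed.

Let mdist_triangle Y X Z : mdist X Z <= mdist X Y + mdist Y Z.
Proof.
by apply: hausdorff_dist_triangle;
  exact: cantor_set_neq0 || exact: cantor_set_compact.
Qed.

HB.instance Definition _ := @isMetric.Build R (cantor_sets R N) mdist
  mdistxx mdist_positivity mdist_sym mdist_triangle.

End CantorSets.

Lemma cantor_sets_mdistE (R : realType) (N : nat) (X Y : cantor_sets R N) :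
  mdist X Y = hausdorff_dist X Y.
Proof. by []. Qed.

Lemma cantor_sets_ballE (R : realType) (N : nat) (X : cantor_sets R N) (e : R) :
  ball X e = [set Y : cantor_sets R N | hausdorff_dist X Y < e].
Proof. by rewrite ballEmdist. Qed.

(* Main.v *)
From HB Require Import structures.
Require Import Defs.
From mathcomp Require Import all_boot all_order all_algebra.
From mathcomp Require Import all_classical all_reals all_analysis.
From mathcomp Require Import borel_hierarchy.
From mathcomp Require Import ring lra.

Set Implicit Arguments.
Unset Strict Implicit.
Unset Printing Implicit Defensive.

Import Order.TTheory GRing.Theory Num.Theory.
Import numFieldNormedType.Exports.

Local Open Scope classical_set_scope.
Local Open Scope ring_scope.

(** Orthogonal projections are the symmetric idempotent matrices [P].  A triple
    [(P, a, b)] with [a], [b] in [X], [|bP - aP| >= e] and every [x] in [X]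
    satisfying [xP = aP] or [|xP - aP| >= e] certifies that [X] belongs to the
    set.  For [e = 1/(n+1)] and [|P|, |a|, |b| <= n] the condition on
    [(X, (P, (a, b)))] is closed, so by compactness of the space of triples the
    [X] having such a certificate form a closed set; these closed sets exhaust
    the set as [n] grows.

    They have empty interior because finite unions of translates of [d C^N] are
    dense, [C] being the middle-thirds set.  Such a union [Y] is a Cantor set,
    by the characterization through compactness, perfectness and
    zero-dimensionality: each coordinate takes values in a set that is nowhere
    dense in the line.  Any point of [Y] can be moved inside [Y] by arbitrarily
    small nonzero amounts along each coordinate axis, and a nonzero projection
    does not kill every axis, so no projection of [Y] onto a nonzero subspace
    has an isolated point. *)

(** * The middle-thirds set *)

Section MiddleThirdsTheory.
Variable R : realType.
Implicit Types t x y : R.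

Lemma middle_thirds_itv t : middle_thirds R t -> 0 <= t <= 1.
Proof. by move=> /(_ 0%N I) /=; rewrite in_itv. Qed.

Lemma middle_thirds_step_itv n t : middle_thirds_step R n t -> 0 <= t <= 1.
Proof.
elim: n t => [t /=|n IH t /=]; first by rewrite in_itv.
by move=> [[u /IH u01 <-]|[u /IH u01 <-]]; lra.
Qed.

Lemma middle_thirds_left t : middle_thirds R t -> middle_thirds R (t / 3).
Proof.
move=> Ct [|n] _ /=; last by left; exists t => //; exact: Ct.
by have := middle_thirds_itv Ct; rewrite in_itv /=; lra.
Qed.

Lemma middle_thirds_right t :
  middle_thirds R t -> middle_thirds R ((t + 2) / 3).
Proof.
move=> Ct [|n] _ /=; last by right; exists t => //; exact: Ct.
by have := middle_thirds_itv Ct; rewrite in_itv /=; lra.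
Qed.

(** Points of the first third and of the last third lie on different sides of [1/2]. Hence the side
    of [t] decides which branch is taken at every step, and one preimage [u] serves for all [n]. *)
Lemma middle_thirds_split t : middle_thirds R t ->
  exists2 u, middle_thirds R u & t = u / 3 \/ t = (u + 2) / 3.
Proof.
move=> Ct; have [t2|t2] := lerP t 2^-1.
  exists (t * 3); last by left; field.
  move=> n _; have [[u Cu <-]|[u Cu ut]] := Ct n.+1 I; first by rewrite divfK.
  by have := middle_thirds_step_itv Cu; lra.
exists (t * 3 - 2); last by right; field.
move=> n _; have [[u Cu ut]|[u Cu <-]] := Ct n.+1 I.
  by have := middle_thirds_step_itv Cu; lra.
by rewrite divfK// addrK.
Qed.

(** Self-similarity: a displacement of the preimage [u] within the set, divided by 3, is a
    displacement of [t] at the next scale. *)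
Lemma middle_thirds_perfect t n : middle_thirds R t ->
  exists h, [/\ h != 0, `|h| <= 3^-1 ^+ n & middle_thirds R (t + h)].
Proof.
elim: n t => [|n IH] t Ct.
  have t01 := middle_thirds_itv Ct.
  have C0 := middle_thirds0 R; have C1 : middle_thirds R 1.
    move=> n _; elim: n => [|n IH] /=; first by rewrite in_itv /= lexx ler01.
    by right; exists 1 => //; field.
  (* At scale 1 an endpoint is a valid target: [0] moves to [1], and any other point moves to
     [0]. *)
  have [->|t0] := eqVneq t 0.
    by exists 1; rewrite oner_neq0 normr1 expr0 add0r.
  case/andP: t01 => t_ge0 t_le1; exists (- t).
  by rewrite oppr_eq0 t0 subrr normrN expr0 ger0_norm.
have [u Cu tu] := middle_thirds_split Ct; have [h [h0 hn Ch]] := IH u Cu.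
exists (h / 3); split.
- by rewrite mulf_neq0// invr_eq0.
- by rewrite normrM (@ger0_norm _ 3^-1) ?invr_ge0// exprSr ler_pM2r// invr_gt0.
- case: tu => ->; rewrite ?(addrAC _ 2) -mulrDl.
    exact: middle_thirds_left.
  by rewrite addrAC; exact: middle_thirds_right.
Qed.

(** This is nowhere density in the line, with the gap given by its endpoints so that a level missed
    by [E] can be picked between any two numbers. *)
Definition gappy (E : set R) := forall x y, x < y ->
  exists x' y', [/\ x <= x', x' < y', y' <= y &
    forall t, x' < t -> t < y' -> ~ E t].

(** Induction on [n] for intervals longer than [3^-n]. An interval on one side of [1/2] is tripled
    and handled at the previous scale; an interval around [1/2] meets the removed middle third. *)
Lemma gappy_middle_thirds : gappy (middle_thirds R).
Proof.
suff gap n x y : x < y -> 3^-1 ^+ n < y - x -> exists x' y',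
    [/\ x <= x', x' < y', y' <= y &
      forall t, x' < t -> t < y' -> ~ middle_thirds R t].
  move=> x y xy; have : 0 < y - x by rewrite subr_gt0.
  have h3 : `|3^-1 : R| < 1 by rewrite ger0_norm ?invr_ge0//; lra.
  have /cvgrPdist_lt c3 := cvg_expr h3.
  move=> /c3[n _ /(_ n (leqnn n))] /=.
  rewrite distrC subr0 ger0_norm ?exprn_ge0 ?invr_ge0//.
  exact: gap.
elim: n x y => [|n IH] x y xy; rewrite ?expr0 ?exprS => nxy.
  (* An interval longer than 1 sticks out of [[0, 1]] on the left or on the right. *)
  have [x0|x0] := ltP x 0.
    exists x, (Num.min 0 y); split=> //.
    - by rewrite lt_min x0.
    - by rewrite ge_min lexx orbT.
    - by move=> t _; rewrite lt_min => /andP[t0 _] /middle_thirds_itv; lra.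
  exists (Num.max 1 x), y; split=> //.
  - by rewrite le_max lexx orbT.
  - by rewrite gt_max xy andbT; lra.
  - by move=> t; rewrite gt_max => /andP[t1 _] _ /middle_thirds_itv; lra.
have [y2|y2] := lerP y 2^-1.
  have [||x' [y' [xx' xy' yy' gap]]] := IH (x * 3) (y * 3); [lra|lra|].
  exists (x' / 3), (y' / 3); split; [lra|lra|lra|move=> t tx ty Ct].
  have [u Cu [tu|tu]] := middle_thirds_split Ct.
    by apply: (gap u) => //; lra.
  by have := middle_thirds_itv Cu; lra.
have [x2|x2] := lerP 2^-1 x.
  have [||x' [y' [xx' xy' yy' gap]]] := IH (x * 3 - 2) (y * 3 - 2); [lra|lra|].
  exists ((x' + 2) / 3), ((y' + 2) / 3); split; [lra|lra|lra|move=> t tx ty Ct].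
  have [u Cu [tu|tu]] := middle_thirds_split Ct.
    by have := middle_thirds_itv Cu; lra.
  by apply: (gap u) => //; lra.
exists (Num.max x 3^-1), (Num.min y (2 / 3)); split.
- by rewrite le_max lexx.
- by rewrite gt_max !lt_min; apply/andP; split; apply/andP; split; lra.
- by rewrite ge_min lexx.
- move=> t; rewrite gt_max lt_min => /andP[_ t1] /andP[_ t2] Ct.
  by have [u Cu [tu|tu]] := middle_thirds_split Ct;
    have := middle_thirds_itv Cu; lra.
Qed.

Lemma gappy0 : gappy set0.
Proof. by move=> x y xy; exists x, y; split=> // t _ _ []. Qed.

(** The gap of [F] is sought inside the gap already found for [E]. *)
Lemma gappyU E F : gappy E -> gappy F -> gappy (E `|` F).
Proof.
move=> gE gF x y /gE[x' [y' [xx' /gF[x'' [y'' [xx'' xy'' yy'' Fg]]] yy' Eg]]].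
exists x'', y''; split=> //; [exact: le_trans xx''|exact: le_trans yy'|].
move=> t xt ty [Et|]; last exact: Fg.
by apply: Eg Et; [exact: le_lt_trans xt|exact: lt_le_trans yy''].
Qed.

Lemma gappy_affine E (d c : R) : 0 < d -> gappy E ->
  gappy [set t | E ((t - c) / d)].
Proof.
move=> d0 gE x y xy; have [|x' [y' [xx' xy' yy' Eg]]] := gE ((x - c) / d) ((y - c) / d).
  by rewrite ltr_pM2r ?invr_gt0// ltrD2r.
exists (x' * d + c), (y' * d + c); split.
- by rewrite -lerBlDr -ler_pdivrMr.
- by rewrite ltrD2r ltr_pM2r.
- by rewrite -lerBrDr -ler_pdivlMr.
- move=> t tx ty; apply: Eg.
    by rewrite ltr_pdivlMr// ltrBrDr.
  by rewrite ltr_pdivrMr// ltrBlDr.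
Qed.

End MiddleThirdsTheory.

(** * Subsets homeomorphic to the Cantor space *)

Section Homeomorphic.
Implicit Types S T U : topologicalType.

Lemma homeomorphic_sym S T : homeomorphic S T -> homeomorphic T S.
Proof. by move=> [f [g [cf cg fK gK]]]; exists g, f. Qed.

Lemma homeomorphic_trans T S U :
  homeomorphic S T -> homeomorphic T U -> homeomorphic S U.
Proof.
move=> [f [g [cf cg fK gK]]] [f' [g' [cf' cg' fK' gK']]].
exists (f' \o f), (g \o g'); split.
- by move=> x; apply: continuous_comp; [exact: cf|exact: cf'].
- by move=> x; apply: continuous_comp; [exact: cg'|exact: cg].
- exact: can_comp.
- exact: can_comp.
Qed.

End Homeomorphic.

Section CantorLikeSubsets.
Context {R : realType}.

(** Brouwer's characterization yields a continuous closed bijection [f] from the Cantor space.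
    Preimages under its inverse are images under [f], so closedness of [f] is continuity of the
    inverse. *)
Lemma cantor_like_homeomorphic (T : pseudoMetricType R) : T ->
  cantor_like T -> homeomorphic T cantor_space.
Proof.
move=> t0 cT.
(* The characterization concerns pointed spaces; [t0] serves as the point. *)
pose P : pseudoPMetricType R := HB.pack T (isPointed.Build T t0).
have [f [cf clf]] := @homeomorphism_cantor_like R P cT.
exists f^-1%FUN, f; split.
- apply/continuous_closedP => A cA.
  suff -> : f^-1%FUN @^-1` A = f @` A by exact: clf.
  apply/seteqP; split=> [x Ax|_ [x Ax <-]] /=; last by rewrite funK ?inE.
  by exists (f^-1%FUN x) => //; rewrite invK ?inE.
- exact: cf.
- by move=> x; rewrite invK ?inE.
- by move=> x; rewrite funK ?inE.
Qed.

Lemma compact_set_type (T : topologicalType) (A : set T) :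
  compact A -> compact [set: A].
Proof.
move=> cA F PF _; have [|x [Ax clx]] := cA (set_val @ F) _.
  by apply: (@nearW _ F) => y; exact: set_valP.
exists (exist _ x (mem_set Ax)); split=> // U V FU [_ /= [[W oW <-] /= Wx WV]].
have [|y [[u Uu <-] Wu]] := clx (set_val @` U) W _ (open_nbhs_nbhs (conj oW Wx)).
  by apply: (@filterS _ F _ U) => // u Uu; exists u.
by exists u; split=> //; exact: WV.
Qed.

Lemma zero_dimensional_hausdorff (T : topologicalType) :
  zero_dimensional T -> hausdorff_space T.
Proof.
move=> zT x y clxy; apply/eqP/negP => /negP/zT[U [[oU cU] Ux Uy]].
have oUC : open (~` U) by exact: closed_openC.
have [||z []//] := clxy U (~` U).
- exact: open_nbhs_nbhs.
- exact: open_nbhs_nbhs.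
Qed.

Definition level_separated (T : topologicalType) (A : set T) :=
  forall x y, A x -> A y -> x <> y -> exists (f : T -> R) c,
    [/\ continuous f, f x < c, c < f y & forall z, A z -> f z <> c].

(** Since [f] avoids the level [c] on [A], the conditions [f < c] and [f <= c] cut out the same
    subset of [A], which is therefore clopen. *)
Lemma level_separated_zero_dimensional (T : topologicalType) (A : set T) :
  level_separated A -> zero_dimensional A.
Proof.
move=> sepA x y xy.
have [||| f [c [cf fx fy fA]]] := sepA (set_val x) (set_val y).
- exact: set_valP.
- exact: set_valP.
- by move=> /val_inj xyE; rewrite xyE eqxx in xy.
have cfv : continuous (f \o (set_val : A -> T)).
  by move=> z; apply: continuous_comp; [exact: initial_continuous|exact: cf].
exists [set z | f (set_val z) < c]; split=> //=; last first.
  by apply/negP; rewrite -leNgt ltW.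
split.
  exact: (open_comp (f := f \o set_val) (D := [set t | t < c])).
rewrite (_ : mkset _ = [set z : A | f (set_val z) <= c]).
  exact: (closed_comp (f := f \o set_val) (D := [set t | t <= c])).
apply/seteqP; split=> [z /=|z /=]; first exact: ltW.
by rewrite le_eqVlt => /predU1P[/fA|//]; case; exact: set_valP.
Qed.

Lemma perfect_set_type (T : topologicalType) (A : set T) :
  (forall x U, A x -> nbhs x U -> exists2 y, A y & y <> x /\ U y) ->
  perfect_set [set: A].
Proof.
move=> perfA; apply/perfectTP => x ox.
have [W oW Wx] := ox.
have [|y Ay [yx Wy]] := perfA (set_val x) W (set_valP x).
  apply: open_nbhs_nbhs; split=> //.
  by have : [set x] x by []; rewrite -Wx.
have : (set_val @^-1` W) (exist _ y (mem_set Ay) : A) by [].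
by rewrite Wx => /= yE; apply: yx; rewrite -yE.
Qed.

Lemma cantor_subset_homeomorphic (T : pseudoMetricType R) (A : set T) :
  A !=set0 -> compact A -> level_separated A ->
  (forall x U, A x -> nbhs x U -> exists2 y, A y & y <> x /\ U y) ->
  homeomorphic A cantor_space.
Proof.
move=> [a Aa] cA sepA perfA.
apply: (@cantor_like_homeomorphic A).
  exact: (exist _ a (mem_set Aa)).
split.
- exact: perfect_set_type.
- exact: compact_set_type.
- exact/zero_dimensional_hausdorff/level_separated_zero_dimensional.
- exact: level_separated_zero_dimensional.
Qed.

(** Cantor sets are defined through [middle_thirds], while the topological characterization produces
    [cantor_space]; this links the two models. *)
Lemma middle_thirds_homeomorphic : homeomorphic (middle_thirds R) cantor_space.
Proof.
apply: cantor_subset_homeomorphic.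
- by exists 0; exact: middle_thirds0.
- exact: middle_thirds_compact.
- move=> x y Cx Cy xy.
  have gap u v : u < v -> exists c, [/\ u < c, c < v & ~ middle_thirds R c].
    move=> /gappy_middle_thirds[u' [v' [uu' uv' vv' Cuv]]].
    by exists ((u' + v') / 2); split; [lra|lra|apply: Cuv; lra].
  have [/gap[c [xc cy Cc]]|yx|xyE] := ltgtP x y.
  + exists id, c; split=> // z Cz zc; first exact.
    by rewrite -zc in Cc.
  + have [c [yc cx Cc]] := gap _ _ yx.
    (* Negation restores the order required by [level_separated] when [y < x]. *)
    exists -%R, (- c); split; rewrite ?ltrN2//.
      exact: oppr_continuous.
    by move=> z Cz /oppr_inj zc; rewrite -zc in Cc.
  + by [].
- move=> x U Cx /nbhs_ballP[e /= e0 eU].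
  have h3 : `|3^-1 : R| < 1 by rewrite ger0_norm ?invr_ge0//; lra.
  have /cvgrPdist_lt c3 := cvg_expr h3.
  have [n _ /(_ n (leqnn n))] := c3 _ e0.
  rewrite /= distrC subr0 ger0_norm ?exprn_ge0 ?invr_ge0// => ne.
  have [h [h0 hn Ch]] := middle_thirds_perfect n Cx.
  exists (x + h) => //; split.
    by move/eqP; rewrite -subr_eq0 addrAC subrr add0r (negbTE h0).
  apply: eU; rewrite /ball /= opprD addrA subrr add0r normrN.
  exact: le_lt_trans ne.
Qed.

End CantorLikeSubsets.

(** * Cantor dust *)

Section CantorDust.
Context {R : realType} {N : nat}.
Implicit Types (S : seq 'rV[R]_N) (x y : 'rV[R]_N) (d e : R).

(** This is the union of the translates [x + d C^N] for [x] in [S], with [C] the middle-thirds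
    set. *)
Definition cantor_dust S d : set 'rV[R]_N := [set y |
  exists2 x, x \in S & forall i, middle_thirds R ((y ord0 i - x ord0 i) / d)].

Lemma compact_cantor_dust S d : 0 < d -> compact (cantor_dust S d).
Proof.
move=> d0; elim: S => [|x S IH].
  rewrite (_ : cantor_dust _ _ = set0); first exact: compact0.
  by apply/seteqP; split=> // y [].
rewrite (_ : cantor_dust _ _ = [set y : 'rV[R]_N | forall i,
    [set t | middle_thirds R ((t - x ord0 i) / d)] (y ord0 i)]
    `|` cantor_dust S d); last first.
  apply/seteqP; split=> y.
    move=> [x']; rewrite inE => /predU1P[->|Sx'] Cy; first by left.
    by right; exists x'.
  by move=> [Cy|[x' Sx' Cy]]; [exists x|exists x'];
    rewrite // inE ?eqxx// Sx' orbT.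
apply: compactU => //.
apply: (@rV_compact _ _ (fun i => [set t | middle_thirds R ((t - x ord0 i) / d)])).
move=> i.
rewrite (_ : mkset _ = (fun t => t * d + x ord0 i) @` middle_thirds R).
  apply: continuous_compact (@middle_thirds_compact R).
  apply: continuous_subspaceT => t; apply: cvgD; last exact: cvg_cst.
  by apply: cvgM; [exact: cvg_id|exact: cvg_cst].
apply/seteqP; split=> [t /= Ct|_ [t Ct <-] /=].
  by exists ((t - x ord0 i) / d) => //; rewrite divfK ?gt_eqF// subrK.
by rewrite addrK mulfK// gt_eqF.
Qed.

(** The set contains all values of the [i]-th coordinate on the dust, and it is a finite union of
    affine copies of the middle-thirds set. *)
Lemma gappy_cantor_dust S d (i : 'I_N) : 0 < d -> gappy
  [set t | exists2 x, x \in S & middle_thirds R ((t - x ord0 i) / d)].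
Proof.
move=> d0; elim: S => [|x S IH].
  by rewrite (_ : mkset _ = set0); [exact: gappy0|rewrite -subset0 => t []].
rewrite (_ : mkset _ = [set t | middle_thirds R ((t - x ord0 i) / d)] `|`
    [set t | exists2 x, x \in S & middle_thirds R ((t - x ord0 i) / d)]).
  by apply: gappyU => //; apply: gappy_affine => //; exact: gappy_middle_thirds.
apply/seteqP; split=> t.
  move=> [x']; rewrite inE => /predU1P[->|Sx'] Cy; first by left.
  by right; exists x'.
by move=> [Cy|[x' Sx' Cy]]; [exists x|exists x'];
  rewrite // inE ?eqxx// Sx' orbT.
Qed.

(** Distinct points differ in some coordinate, and a level between the two values can be taken in a
    gap of that coordinate. *)
Lemma level_separated_cantor_dust S d : 0 < d ->
  level_separated (R := R) (cantor_dust S d).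
Proof.
move=> d0 x y Sx Sy xy.
have [i xyi] : exists i, x ord0 i != y ord0 i.
  apply: contrapT => /forallNP xyE.
  by apply: xy; apply/rowP => i; apply/eqP/negPn/negP/xyE.
have gap u v : u < v -> exists c, [/\ u < c, c < v &
    forall z, cantor_dust S d z -> z ord0 i <> c].
  move=> /(gappy_cantor_dust S i d0)[u' [v' [uu' uv' vv' Cuv]]].
  exists ((u' + v') / 2); split; [lra|lra|move=> z [w Sw Cz] zc].
  by apply: (Cuv (z ord0 i)); [rewrite zc; lra|rewrite zc; lra|exists w].
have ci : continuous (fun z : 'rV[R]_N => z ord0 i) by exact: coord_continuous.
case/lt_total/orP: xyi => [/gap[c [xc cy Cc]]|/gap[c [yc cx Cc]]].
  by exists (fun z : 'rV[R]_N => z ord0 i), c.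
exists (fun z : 'rV[R]_N => - z ord0 i), (- c); split; rewrite ?ltrN2//.
- by move=> z; exact: continuousN (ci z).
- by move=> z /Cc zc /oppr_inj.
Qed.

Lemma cantor_dust_perturb S d y i e : 0 < d -> 0 < e -> cantor_dust S d y ->
  exists h, [/\ h != 0, `|h| < e & cantor_dust S d (y + h *: delta_mx 0 i)].
Proof.
move=> d0 e0 [x Sx Cy].
have h3 : `|3^-1 : R| < 1 by rewrite ger0_norm ?invr_ge0//; lra.
have /cvgrPdist_lt c3 := cvg_expr h3.
(* The displacement is found in the unscaled set and then multiplied by [d], hence the bound
   [e / d]. *)
have [n _ /(_ n (leqnn n))] := c3 _ (divr_gt0 e0 d0).
rewrite /= distrC subr0 ger0_norm ?exprn_ge0 ?invr_ge0// => ne.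
have [h [h0 hn Ch]] := middle_thirds_perfect n (Cy i).
exists (h * d); split.
- by rewrite mulf_neq0// gt_eqF.
- rewrite normrM (gtr0_norm d0) -ltr_pdivlMr//; exact: le_lt_trans ne.
- exists x => // j; rewrite !mxE eqxx /= addrAC mulrDl.
  have [->|ji] := eqVneq j i; first by rewrite mulr1 mulfK ?gt_eqF.
  by rewrite mulr0 mul0r addr0.
Qed.

Lemma norm_delta_row (i : 'I_N) : `|delta_mx 0 i : 'rV[R]_N| <= 1.
Proof.
rewrite [leLHS]mx_normrE; apply/bigmax_leP; split=> // -[a b] _ /=.
by rewrite mxE; case: (_ && _); rewrite ?normr1 ?normr0.
Qed.

Lemma delta_row_neq0 (i : 'I_N) : delta_mx 0 i != 0 :> 'rV[R]_N.
Proof.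
by apply/eqP => /rowP /(_ i); rewrite !mxE !eqxx => /eqP; rewrite oner_eq0.
Qed.

Lemma cantor_dust_is_cantor S d : (0 < N)%N -> S != [::] -> 0 < d ->
  is_cantor_space R (cantor_dust S d).
Proof.
move=> N0 S0 d0; apply: homeomorphic_trans; last first.
  exact: homeomorphic_sym (@middle_thirds_homeomorphic R).
apply: cantor_subset_homeomorphic.
- case: S S0 => // x S _; exists x; exists x; first exact: mem_head.
  by move=> i; rewrite subrr mul0r; exact: middle_thirds0.
- exact: compact_cantor_dust.
- exact: level_separated_cantor_dust.
- move=> y U Sy /nbhs_ballP[e /= e0 eU]; pose i := Ordinal N0.
  have [h [h0 he Sh]] := cantor_dust_perturb i d0 e0 Sy.
  exists (y + h *: delta_mx 0 i) => //; split.
    move/eqP; rewrite -subr_eq0 addrAC subrr add0r scaler_eq0 (negbTE h0) /=.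
    by rewrite (negbTE (delta_row_neq0 i)).
  apply: eU; rewrite -ball_normE /ball_ /= opprD addrA subrr add0r normrN normrZ.
  by rewrite (le_lt_trans _ he)// ler_piMr// norm_delta_row.
Qed.

Lemma cantor_dust_near S d y : 0 < d -> cantor_dust S d y ->
  exists2 x, x \in S & `|y - x| <= d.
Proof.
move=> d0 [x Sx Cy]; exists x => //.
rewrite [leLHS]mx_normrE; apply/bigmax_leP; split=> [|[a i] _ /=]; first exact: ltW.
rewrite ord1 !mxE; have /andP[c0 c1] := middle_thirds_itv (Cy i).
rewrite -[_ - _](divfK (lt0r_neq0 d0)) normrM (gtr0_norm d0) ger0_norm//.
by rewrite ler_piMl// ltW.
Qed.

Lemma sub_cantor_dust S d x : x \in S -> cantor_dust S d x.
Proof.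
by exists x => // i; rewrite subrr mul0r; exact: middle_thirds0.
Qed.

End CantorDust.

(** * Orthogonal projections as matrices *)

Section ProjectionMatrices.
Context {R : realType} {N : nat}.
Implicit Types (L : {vspace 'rV[R]_N}) (P : 'M[R]_N) (x y : 'rV[R]_N).

Definition proj_matrix P : Prop := P^T = P /\ P *m P = P.

Lemma dotv_mulmx x y : dotv x y = (x *m y^T) 0 0.
Proof. by rewrite mxE; apply: eq_bigr => i _; rewrite mxE. Qed.

Lemma orth_proj_unique L x y : y \in L ->
  {in L, forall z, dotv (x - y) z = 0} -> orth_proj L x = y.
Proof.
move=> yL xy; have [pL xp] := orth_projP L x.
have dL : orth_proj L x - y \in L by rewrite rpredB.
apply/eqP; rewrite -subr_eq0; apply/eqP/dotvv_eq0.
have {1}-> : orth_proj L x - y = (x - y) + (-1) *: (x - orth_proj L x).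
  by rewrite scaleN1r opprB [RHS]addrC addrA subrK.
by rewrite dotvDl dotvZl xy// xp// mulr0 addr0.
Qed.

Lemma orth_proj_matrix L :
  exists2 P, proj_matrix P & forall x, orth_proj L x = x *m P.
Proof.
pose P : 'M[R]_N := lin1_mx (orth_proj L).
have PE x : orth_proj L x = x *m P.
  by rewrite /P /orth_proj mul_rV_lin1.
(* Here [xP] lies in [L] and [y - yP] is orthogonal to [L]. The right-hand side is symmetric in [x]
   and [y], which makes [P] symmetric. *)
have pp x y : dotv (x *m P) y = dotv (x *m P) (y *m P).
  have [xL _] := orth_projP L x; have [_ yL] := orth_projP L y.
  rewrite -!PE; apply/eqP; rewrite -subr_eq0 -[X in _ - X]mul1r -mulNr -dotvZr.
  by rewrite -dotvDr scaleN1r dotvC yL.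
exists P => //; split.
  apply/matrixP => i j; rewrite mxE.
  have dE k (x : 'rV[R]_N) : dotv x (delta_mx 0 k) = x 0 k.
    by rewrite dotv_mulmx trmx_delta -colE mxE.
  have rE k l : P k l = dotv (delta_mx 0 k *m P) (delta_mx 0 l).
    by rewrite dE -rowE [RHS]mxE.
  by rewrite !rE pp dotvC -pp.
apply/row_matrixP => i; rewrite row_mul; apply/esym.
rewrite -PE; have [L1 _] := orth_projP L (delta_mx 0 i).
rewrite rowE -PE; apply/esym/orth_proj_unique => // z _.
by rewrite subrr dot0v.
Qed.

(** The subspace is the row space of [P]: symmetry moves [P] across the dot product, and idempotence
    gives [(x - xP)P = 0]. *)
Lemma proj_matrix_orth_proj P : proj_matrix P ->
  exists L, forall x, orth_proj L x = x *m P.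
Proof.
move=> [Psym Pidem]; exists (limg (linfun (mulmxr P))) => x.
apply: orth_proj_unique.
  by apply/memv_imgP; exists x; rewrite ?memvf// lfunE.
move=> _ /memv_imgP[z _ ->]; rewrite lfunE /= dotv_mulmx trmx_mul Psym.
by rewrite mulmxA mulmxBl -[x *m P *m P]mulmxA Pidem subrr mul0mx mxE.
Qed.

End ProjectionMatrices.

(** * Topology of spaces of matrices *)

Section MatrixContinuity.
Context {R : realType}.

Lemma cvg_mx_entries (T : Type) (F : set_system T) m n
    (f : T -> 'M[R]_(m, n)) (M : 'M[R]_(m, n)) : Filter F ->
  (forall i j, f x i j @[x --> F] --> M i j) -> f x @[x --> F] --> M.
Proof.
move=> FF fM A [B MB BA]; apply: (@filterS _ F _ [set x | forall i j, B i j (f x i j)]).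
  by move=> x; exact: BA.
by apply: filter_forall => i; apply: filter_forall => j; exact: fM (MB i j).
Qed.

Lemma continuous_mulmx m n p : continuous
  (fun z : 'M[R]_(m, n) * 'M[R]_(n, p) => z.1 *m z.2).
Proof.
move=> z; apply: cvg_mx_entries => i j; rewrite mxE.
under eq_cvg do rewrite mxE.
apply: cvg_big => [|k _]; first exact: add_continuous.
apply: cvgM.
- exact: (continuous_comp (@cvg_fst _ _ _ _ _) (@coord_continuous _ _ _ i k _)).
- exact: (continuous_comp (@cvg_snd _ _ _ _ _) (@coord_continuous _ _ _ k j _)).
Qed.

Lemma mx_norm_le m n (A : 'M[R]_(m, n)) (M : R) : 0 <= M ->
  (forall i j, `|A i j| <= M) -> `|A| <= M.
Proof.
by move=> M0 AM; rewrite [leLHS]mx_normrE; apply/bigmax_leP; split=> // -[i j].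
Qed.

Lemma mx_entry_le_norm m n (A : 'M[R]_(m, n)) i j : `|A i j| <= `|A|.
Proof. by rewrite [leRHS]mx_normrE; exact: (le_bigmax _ _ (i, j)). Qed.

Lemma compact_mx_bounded m n (M : R) : 0 <= M ->
  compact [set A : 'M[R]_(m, n) | `|A| <= M].
Proof.
(* The sup-norm ball is the image of a cube of row vectors, which is a product of segments. *)
move=> M0; pose K := [set v : 'rV[R]_(m * n) | forall i, v ord0 i \in `[- M, M]].
have -> : [set A : 'M[R]_(m, n) | `|A| <= M] = vec_mx @` K.
  apply/seteqP; split=> [A AM|_ [v vM <-]] /=.
    exists (mxvec A); rewrite ?mxvecK// => i.
    case/mxvec_indexP: i => i j; rewrite mxvecE in_itv /= -ler_norml.
    exact: le_trans (mx_entry_le_norm A i j) AM.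
  by apply: mx_norm_le => // i j; rewrite mxE ler_norml; have := vM (mxvec_index i j); rewrite in_itv.
apply: continuous_compact; last first.
  by apply: (@rV_compact _ _ (fun=> `[- M, M]%classic)) => _; exact: segment_compact.
apply: continuous_subspaceT => v.
apply: (@cvg_mx_entries _ (nbhs v) _ _ vec_mx) => i j; rewrite mxE.
by under eq_cvg do rewrite mxE; exact: coord_continuous.
Qed.

End MatrixContinuity.

(** * Closedness of the certified sets *)

Section HausdorffNeighborhoods.
Context {R : realType} {N : nat}.
Implicit Types (X Y : cantor_sets R N) (x y : 'rV[R]_N) (e : R).

Lemma ball_cantor_sets X Y e x : ball X e Y -> cantor_set_val X x ->
  exists2 y, cantor_set_val Y y & `|x - y| < e.
Proof.
rewrite cantor_sets_ballE /= => XY Xx.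
have Y0 := cantor_set_neq0 Y.
have [XYe _] := hausdorff_distP (cantor_set_neq0 X) Y0
  (@cantor_set_compact _ _ X) (@cantor_set_compact _ _ Y) XY.
have /(open_nbhdP _ _ Y0)[y Yy xy] := XYe _ Xx.
exists y => //; apply: le_lt_trans xy.
apply: mx_norm_le => [|i j]; first exact: eucl_dist_ge0.
by rewrite ord1; exact: coord_le_eucl.
Qed.

Lemma near_cantor_sets_meet X x (U : set 'rV[R]_N) : cantor_set_val X x -> nbhs x U ->
  \forall Y \near X, cantor_set_val Y `&` U !=set0.
Proof.
move=> Xx /nbhs_normP[e /= e0 eU]; near=> Y.
have [|y Yy xy] := @ball_cantor_sets X Y e x _ Xx.
  by near: Y; exact: nbhsx_ballx.
by exists y; split=> //; exact: eU.
Unshelve. all: by end_near. Qed.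

(** Some ball of radius [e] about [x] misses the closed set [X]; half of [e] is spent on moving the
    point and half on moving the set. *)
Lemma near_cantor_sets_notin X x : ~ cantor_set_val X x ->
  \forall y \near x & Y \near X, ~ cantor_set_val Y y.
Proof.
move=> Xx; have cX : closed X.
  exact: (compact_closed (@norm_hausdorff _ _) (@cantor_set_compact _ _ X)).
have /nbhs_normP[e /= e0 eX] : nbhs x (~` X).
  by apply: open_nbhs_nbhs; split=> //; exact: closed_openC.
have e2 : 0 < e / 2 by rewrite divr_gt0.
exists (ball x (e / 2), ball X (e / 2)) => /=.
  by split; exact: nbhsx_ballx.
move=> [y Y] /= [xy /ball_sym XY] Yy.
have [z Xz yz] := ball_cantor_sets XY Yy.
apply: (eX z) => //=; rewrite [e]splitr -[x - z](subrKA y) .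
rewrite (le_lt_trans (ler_normD _ _))// ltrD//.
by move: xy; rewrite -ball_normE.
Qed.

End HausdorffNeighborhoods.

Section IsolatedProjections.
Context {R : realType} {N : nat}.
Implicit Types (X Y : cantor_sets R N) (x y : 'rV[R]_N) (e : R).
Implicit Types z : 'M[R]_N * ('rV[R]_N * 'rV[R]_N).

(* [(P, (a, b))] certifies at scale [e] that the image of [X] under [P] has more
   than one point and that [a *m P] is isolated in it. *)
Definition isolation_certificate e X z :=
  [/\ cantor_set_val X z.2.1, cantor_set_val X z.2.2, e <= `|z.2.2 *m z.1 - z.2.1 *m z.1| &
    forall x, cantor_set_val X x -> x *m z.1 = z.2.1 *m z.1 \/
      e <= `|x *m z.1 - z.2.1 *m z.1|].

Definition certificate_box (M : R) :=
  [set z : 'M[R]_N * ('rV[R]_N * 'rV[R]_N) | proj_matrix z.1 /\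
  [/\ `|z.1| <= M, `|z.2.1| <= M & `|z.2.2| <= M]].

Lemma closed_proj_matrix : closed [set P : 'M[R]_N | proj_matrix P].
Proof.
have closed0 (f : 'M[R]_N -> 'M[R]_N) : continuous f -> closed [set P | f P = P].
  move=> cf; rewrite (_ : mkset _ = [set P | f P - P = 0]); last first.
    apply/seteqP; split=> P /= fP; first by rewrite fP subrr.
    by apply/eqP; rewrite -subr_eq0 fP.
  apply: (closed_comp (f := fun P => f P - P) (D := [set 0])).
    by move=> P _; exact: (@cvgB _ _ _ (nbhs P) _ f id _ _ (cf P) cvg_id).
  exact: accessible_closed_set1 (hausdorff_accessible (@norm_hausdorff _ _)) _.
apply: closedI; apply: closed0.
  move=> P; apply: (@cvg_mx_entries _ _ (nbhs P) _ _ trmx) => i j; rewrite mxE.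
  by under eq_cvg do rewrite mxE; exact: coord_continuous.
move=> P; apply: (@continuous_comp _ _ _ (fun P : 'M[R]_N => (P, P))
  (fun z : 'M[R]_N * 'M[R]_N => z.1 *m z.2)).
  exact: (@cvg_pair _ _ _ (nbhs P) (nbhs P) (nbhs P) _ _ _ id id).
exact: continuous_mulmx.
Qed.

Lemma compact_certificate_box M : 0 <= M -> compact (certificate_box M).
Proof.
move=> M0; have cM m n := @compact_mx_bounded R m n M M0.
have cB := compact_setX (cM N N) (compact_setX (cM 1%N N) (cM 1%N N)).
apply: (subclosed_compact _ cB); last by move=> z [_ []].
rewrite (_ : certificate_box M = (fst @^-1` [set P | proj_matrix P]) `&`
  ([set P : 'M[R]_N | `|P| <= M] `*` ([set a : 'rV[R]_N | `|a| <= M] `*`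
    [set b : 'rV[R]_N | `|b| <= M]))).
  apply: closedI; last by apply: compact_closed cB; exact: norm_hausdorff.
  apply: closed_comp closed_proj_matrix => z _; exact: cvg_fst.
by apply/seteqP; split=> z [? []] => [|? []].
Qed.

(** Each way of failing is open: [a] or [b] lies outside [X], the two images are closer than [e], or
    some [x] in [X] has its image at distance strictly between [0] and [e] from [aP]. *)
Lemma near_not_isolation_certificate e X z : ~ isolation_certificate e X z ->
  \forall z' \near z & Y \near X, ~ isolation_certificate e Y z'.
Proof.
have c1 : continuous (fun z => z.1) by move=> z'; exact: cvg_fst.
have c21 : continuous (fun z => z.2.1).
  by move=> z'; exact: (@continuous_comp _ _ _ snd fst _ cvg_snd cvg_fst).
have c22 : continuous (fun z => z.2.2).
  by move=> z'; exact: (@continuous_comp _ _ _ snd snd _ cvg_snd cvg_snd).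
have cmul (T : topologicalType) (f : T -> 'rV[R]_N) (g : T -> 'M[R]_N) :
    continuous f -> continuous g -> continuous (fun t => f t *m g t).
  move=> cf cg t; apply: (@continuous_comp _ _ _ (fun t => (f t, g t))
    (fun u : 'rV[R]_N * 'M[R]_N => u.1 *m u.2)); last exact: continuous_mulmx.
  exact: (@cvg_pair _ _ _ (nbhs t) _ _ _ _ _ f g (cf t) (cg t)).
have notin (h : _ -> 'rV[R]_N) : continuous h -> ~ cantor_set_val X (h z) ->
    \forall z' \near z & Y \near X, ~ cantor_set_val Y (h z').
  move=> ch /near_cantor_sets_notin[[A B] /= [nA nB] AB].
  exists (h @^-1` A, B) => /=; first by split=> //; exact: ch.
  by move=> [z' Y] /= [Az' BY]; exact: (AB (h z', Y)).
move=> nz; have [Xa|Xa] := pselect (cantor_set_val X z.2.1); last first.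
  by apply: filterS (notin _ c21 Xa) => -[z' Y] /= nY [].
have [Xb|Xb] := pselect (cantor_set_val X z.2.2); last first.
  by apply: filterS (notin _ c22 Xb) => -[z' Y] /= nY [].
have [eab|abe] := lerP e `|z.2.2 *m z.1 - z.2.1 *m z.1|; last first.
  have cd : continuous (fun z => z.2.2 *m z.1 - z.2.1 *m z.1).
    by move=> z'; exact: cvgB (cmul _ _ _ c22 c1 z') (cmul _ _ _ c21 c1 z').
  have nA := cvgr_norm_lt (FF := nbhs_filter z) _ (cd z) _ abe.
  exists ([set z' | `|z'.2.2 *m z'.1 - z'.2.1 *m z'.1| < e], setT) => /=.
    by split=> //; exact: filterT.
  by move=> [z' Y] /= [ze _] [_ _]; rewrite leNgt ze.
have [x [Xx xa xe]] : exists x, [/\ cantor_set_val X x,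
    x *m z.1 - z.2.1 *m z.1 != 0 & `|x *m z.1 - z.2.1 *m z.1| < e].
  apply: contrapT => /forallNP nx; apply: nz; split=> // x Xx.
  have [xa|xa] := eqVneq (x *m z.1) (z.2.1 *m z.1); [by left|right].
  by rewrite leNgt; apply/negP => xe; apply: (nx x); rewrite subr_eq0.
have cd : continuous (fun t : 'rV[R]_N * ('M[R]_N * ('rV[R]_N * 'rV[R]_N)) => t.1 *m t.2.1 - t.2.2.1 *m t.2.1).
  have c2 (T : topologicalType) (f : _ -> T) : continuous f ->
      continuous (fun t : 'rV[R]_N * ('M[R]_N * ('rV[R]_N * 'rV[R]_N)) => f t.2).
    move=> cf t; apply: (@continuous_comp _ _ _ snd f); last exact: cf.
    exact: cvg_snd.
  move=> t; apply: cvgB; last exact: c2 _ _ (cmul _ _ _ c21 c1) t.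
  by apply: (cmul _ fst); [move=> u; exact: cvg_fst|exact: c2].
(* Both strict inequalities persist for [(y, z')] near [(x, z)], and every [Y] close to [X] contains
   such a [y]. *)
have nlt := cvgr_norm_lt (FF := nbhs_filter (x, z)) _ (cd (x, z)) _ xe.
have nneq := cvgr_neq0 (FF := nbhs_filter (x, z)) _ (cd (x, z)) xa.
have [[U A] /= [nU nA] UA] := filterI nlt nneq.
exists (A, [set Y | cantor_set_val Y `&` U !=set0]) => /=.
  by split=> //; exact: near_cantor_sets_meet Xx nU.
move=> [z' Y] /= [Az' [y [Yy Uy]]] [_ _ _ /(_ _ Yy)].
have [] := UA (y, z') (conj Uy Az') => /= ylt yneq.
by case=> [/eqP|]; [rewrite -subr_eq0 (negbTE yneq)|rewrite leNgt ylt].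
Qed.

(** Projection along a compact factor is closed: the neighbourhoods of [X] on which the single [z]
    fail to certify combine, by compactness of the box, into one that works for the whole box. *)
Lemma closed_isolation e M : 0 <= M -> closed [set X : cantor_sets R N |
  exists2 z, certificate_box M z & isolation_certificate e X z].
Proof.
move=> M0; rewrite closedE => X; apply: contra_notP => nX.
have /compact_near_coveringP cov := compact_certificate_box M0.
have := cov _ _ (fun Y z => ~ isolation_certificate e Y z) (nbhs_filter X).
move=> near_no; have {near_no} : \near X, certificate_box M `<=` [set z | ~ isolation_certificate e X z].
  apply: near_no => z Bz; apply: near_not_isolation_certificate => cz.
  by apply: nX; exists z.
by apply: filterS => Y noY [z /noY].
Qed.

End IsolatedProjections.

(** * Density of the complement *)

Definition isolated_projection_set (R : realType) (N : nat) :=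
  [set X : cantor_sets R N | exists L : {vspace 'rV[R]_N},
    [/\ L != 0%VS,
        ~~ (orth_proj L @` X #<= `I_1)%card &
        isolated (orth_proj L @` X) !=set0]].

Definition certified_set (R : realType) (N : nat) (n : nat) :=
  [set X : cantor_sets R N |
    exists2 z, certificate_box n%:R z & isolation_certificate n.+1%:R^-1 X z].

Arguments isolated_projection_set : clear implicits.
Arguments certified_set : clear implicits.

Section Genericity.
Context {R : realType} {N : nat}.
Implicit Types (X Y : cantor_sets R N) (L : {vspace 'rV[R]_N}).

Lemma card_le1P (T : Type) (A : set T) : (A #<= `I_1)%card <-> is_subset1 A.
Proof.
split=> [/pcard_leP/unsquash f x y Ax Ay|A1].
  apply: (@inj _ _ _ f); rewrite ?inE//.
  have f0 z : A z -> f z = 0%N.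
    by move=> /(@funS _ _ _ _ f); rewrite /= ltnS leqn0 => /eqP.
  exact: etrans (f0 _ Ax) (esym (f0 _ Ay)).
have [A0|/set0P/negP/negPn/eqP ->] := pselect (A !=set0); last exact: card_ge0.
have [x Ax] := A0.
apply: (@card_le_trans _ _ _ [set x]); last first.
  by have /card_eqPle[] := @card_set1 _ x.
by apply: subset_card_le => y Ay; exact: A1.
Qed.

Lemma isolated_projection_setE :
  isolated_projection_set R N = \bigcup_n certified_set R N n.
Proof.
apply/seteqP; split=> [X [L [L0 cardL [y [/set_mem[a Xa <-] [V Va VX]]]]]|X [n _ [[P [a b]]]]].
  have [P Pproj PE] := orth_proj_matrix L.
  have [b Xb ab] : exists2 b, cantor_set_val X b & orth_proj L b <> orth_proj L a.
    apply: contrapT => /forall2NP nb; move/negP: cardL; apply; apply/card_le1P.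
    have {}nb b : cantor_set_val X b -> orth_proj L b = orth_proj L a.
      by move=> Xb; case: (nb b) => [//|/contrapT].
    by move=> _ _ [b Xb <-] [c Xc <-]; rewrite nb// nb.
  have /nbhs_normP[e /= e0 eV] := Va.
  have pab : 0 < `|b *m P - a *m P|.
    by rewrite normr_gt0 subr_eq0 -!PE; apply/eqP.
  (* One index [n] must bound the three norms and bring the scale below both the isolating radius
     and the distance of the two images. *)
  have [n [nP na nb ne nab]] : exists n, [/\ `|P| <= n%:R, `|a| <= n%:R,
      `|b| <= n%:R, n.+1%:R^-1 < e & n.+1%:R^-1 < `|b *m P - a *m P|].
    near \oo => n; exists n; split; near: n.
    - exact: nbhs_infty_ger.
    - exact: nbhs_infty_ger.
    - exact: nbhs_infty_ger.
    - exact: near_infty_natSinv_lt (PosNum e0).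
    - exact: near_infty_natSinv_lt (PosNum pab).
  exists n => //; exists (P, (a, b)) => //; split=> //=; first exact: ltW.
  move=> x Xx; rewrite -!PE; have [ltx|lex] := ltrP `|orth_proj L x - orth_proj L a| e.
    left; have : (V `&` orth_proj L @` X) (orth_proj L x).
      by split; [apply: eV; rewrite /= distrC|exists x].
    by rewrite VX.
  by right; rewrite (le_trans (ltW ne)).
move=> [Pproj [/= Pn an bn]] [/= Xa Xb pab sep].
have n0 : 0 < n.+1%:R^-1 :> R by rewrite invr_gt0 ltr0n.
have [L PE] := proj_matrix_orth_proj Pproj; exists L.
have baN : orth_proj L b <> orth_proj L a.
  move=> ba; move: pab; rewrite -!PE ba subrr normr0 leNgt n0.
  by [].
split.
- apply/eqP => L0; apply: baN.
  have p0 x : orth_proj L x = 0.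
    by have [] := orth_projP L x; rewrite {2}L0 memv0 => /eqP.
  by rewrite !p0.
- by apply/negP => /card_le1P L1; apply: baN; apply: L1; [exists b|exists a].
- exists (orth_proj L a); split; first by apply/mem_set; exists a.
  exists (ball (orth_proj L a) n.+1%:R^-1); first exact: nbhsx_ballx.
  apply/seteqP; split=> [y [ya [x Xx xy]]|_ ->] /=.
    move: ya; rewrite -xy -ball_normE /= !PE distrC; case: (sep x Xx) => // h.
    by rewrite ltNge h.
  by split; [exact: ballxx|exists a].
Unshelve. all: by end_near. Qed.

Lemma closed_certified_set n : closed (certified_set R N n).
Proof. exact: closed_isolation. Qed.

Lemma not_isolated_cantor_dust (S : seq 'rV[R]_N) (d : R) L : 0 < d ->
  L != 0%VS -> isolated (orth_proj L @` cantor_dust S d) = set0.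
Proof.
move=> d0 L0; rewrite -subset0 => y [/set_mem ya [V Va VX]].
case: ya Va VX => a Sa <- Va VX.
have [P _ PE] := orth_proj_matrix L.
(* If [P] killed every axis it would vanish, and so would [L], whose vectors are fixed by the
   projection. *)
have [i Pi] : exists i, (delta_mx 0 i : 'rV[R]_N) *m P != 0.
  apply: contrapT => /forallNP P0; move/negP: L0; apply.
  have {}P0 : P = 0.
    apply/row_matrixP => i; rewrite rowE row0.
    by apply/eqP/negPn/negP/P0.
  rewrite -subv0; apply/subvP => v vL.
  have <- : orth_proj L v = v.
    by apply: orth_proj_unique => // z _; rewrite subrr dot0v.
  by rewrite PE P0 mulmx0 mem0v.
have /nbhs_normP[e /= e0 eV] := Va.
have Pi0 : 0 < `|(delta_mx 0 i : 'rV[R]_N) *m P| by rewrite normr_gt0.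
(* Dividing [e] by the norm of the image of the axis vector keeps the projected displacement below
   [e]. *)
have [h [h0 he Sh]] := cantor_dust_perturb i d0 (divr_gt0 e0 Pi0) Sa.
have : (V `&` orth_proj L @` cantor_dust S d) (orth_proj L (a + h *: delta_mx 0 i)).
  split; last by exists (a + h *: delta_mx 0 i).
  apply: eV; rewrite /= !PE mulmxDl opprD addrA subrr add0r normrN -scalemxAl.
  by rewrite normrZ -ltr_pdivlMr.
rewrite VX /= !PE mulmxDl => /eqP; rewrite -subr_eq0 addrAC subrr add0r.
by rewrite -scalemxAl scaler_eq0 (negbTE h0) (negbTE Pi).
Qed.

Lemma compact_net (X : set 'rV[R]_N) (r : R) : 0 < r -> compact X ->
  exists2 S : seq 'rV[R]_N, {subset S <= X} &
    forall x, X x -> exists2 s, s \in S & `|x - s| < r.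
Proof.
move=> r0; rewrite compact_cover => /(_ _ X (fun x => ball x r)).
case=> [x _|x Xx|D DX Xcov].
- exact: ball_open.
- by exists x => //; exact: ballxx.
exists (finmap.enum_fset D) => [x Dx|x /Xcov[s /= Ds]]; first exact/DX.
by rewrite -ball_normE /= distrC => xs; exists s.
Qed.

(** A finite [d]-net of [X] with points in [X] generates a dust of scale [d]: the dust contains the
    net, and each of its points is within [d] of the net in the sup norm. *)
Lemma cantor_dust_dense X (e : R) : (0 < N)%N -> 0 < e ->
  exists Y S d, [/\ 0 < d, ball X e Y & cantor_set_val Y = cantor_dust S d].
Proof.
move=> N0 e0; have sN0 : 0 < Num.sqrt N%:R :> R by rewrite sqrtr_gt0 ltr0n.
(* With this choice [d] times the square root of [N] equals [e / 4], so sup-distance at most [d]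
   forces Euclidean distance below [e / 2]. *)
pose d := e / 2 / (Num.sqrt N%:R + Num.sqrt N%:R).
have d0 : 0 < d by rewrite /d !divr_gt0// addr_gt0.
have de (x y : 'rV[R]_N) : `|x - y| <= d -> eucl_dist x y < e / 2.
  move=> xy; apply: le_lt_trans (eucl_le_norm x y) _.
  apply: (@le_lt_trans _ _ (Num.sqrt N%:R * d)); first by rewrite ler_pM2l.
  rewrite /d mulrCA gtr_pMr ?divr_gt0// ltr_pdivrMr ?addr_gt0//.
  by rewrite mul1r ltrDl.
have [S SX Scov] := compact_net d0 (@cantor_set_compact _ _ X).
have [x0 Xx0] := cantor_set_neq0 X.
have S0 : S != [::].
  by apply/eqP => S0; have [s] := Scov _ Xx0; rewrite S0.
exists (CantorSet (cantor_dust_is_cantor N0 S0 d0)), S, d; split=> //.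
(* The estimate of the Hausdorff distance is not strict, so [e / 2] is aimed at. *)
rewrite cantor_sets_ballE /=; apply: (@le_lt_trans _ _ (e / 2)); last first.
  by rewrite ltr_pdivrMr// mulr_natr mulr2n ltrDl.
apply: hausdorff_dist_le; first by rewrite divr_gt0.
- move=> x Xx; have [s Ss xs] := Scov _ Xx.
  apply/open_nbhdP; first by exists s; exact: sub_cantor_dust.
  by exists s; [exact: sub_cantor_dust|apply: de; exact: ltW].
- move=> y /(cantor_dust_near d0)[s Ss ys].
  apply/open_nbhdP; first by exists x0.
  by exists s; [apply/set_mem/SX|exact: de].
Qed.

(** The set is closed, so an interior point of its closure would have a dust nearby in the set
    itself, and that dust would have a projection with an isolated point. *)
Lemma nowhere_dense_certified_set n : (0 < N)%N ->
  nowhere_dense (certified_set R N n).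
Proof.
move=> N0; rewrite /nowhere_dense -(closure_id _).1; last exact: closed_certified_set.
rewrite -subset0 => X /nbhs_ballP[e /= e0 eF].
have [Y [S [d [d0 XY YE]]]] := cantor_dust_dense X N0 e0.
have : isolated_projection_set R N Y.
  by rewrite isolated_projection_setE; exists n => //; exact: eF.
by move=> [L [L0 _]]; rewrite YE not_isolated_cantor_dust// => -[].
Qed.

End Genericity.

Theorem mainTheorem5 (R : realType) (N : nat) (hN : (1 <= N)%N) :
  let I :=
    [set X : cantor_sets R N | exists L : {vspace 'rV[R]_N},
      [/\ L != 0%VS,
          ~~ (orth_proj L @` X #<= `I_1)%card &
          isolated (orth_proj L @` X) !=set0]] in
  meager I /\ Fsigma I.
Proof.
split; exists (certified_set R N).
- by move=> n; exact: nowhere_dense_certified_set.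
- exact: isolated_projection_setE.
- exact: closed_certified_set.
- exact: isolated_projection_setE.
Qed.
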